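(* Let $\mathcal{M}$, $(U,\varphi)$, $\mathcal{X}=\{z_1,\ldots,z_n\}$, $\Delta_1,\ldots,\Delta_n$, $k$ be as in the context, let $f:U\to\mathbb{R}$ with $f\in C^k(U)$, and let $g_1,\ldots,g_n:U\to\mathbb{R}$ be cardinal basis functions with respect to $\mathcal{X}$ (as defined in the context). For $u\in U$, with $v=\varphi(u)$, set $$T(u;f,z_i,\Delta_i):=\sum_{\beta\in\Delta_i}\frac{D^\beta f(z_i)}{\beta_1!\cdots\beta_m!}\,(v_1-v_1(z_i))^{\beta_1}\cdots(v_m-v_m(z_i))^{\beta_m},\qquad i=1,\ldots,n ,$$ which is formally an incomplete Taylor expansion of $f$ at $z_i$, in the sense that it only includes the partial derivatives whose orders belong to $\Delta_i$. Then the interpolant $$H(u)=\sum_{i=1}^n T(u;f,z_i,\Delta_i)\,g_i(u),\qquad u\in U,$$ satisfies the interpolation conditions $$D^\beta H(z_i)=D^\beta f(z_i),\qquad \beta\in\Delta_i,\quad i=1,\ldots,n.$$ Moreover, $H$ can also be expressed in the form $$H(u)=\sum_{i=1}^n\sum_{\beta\in\Delta_i}D^\beta f(z_i)\,g_{i\beta}(u),\qquad g_{i\beta}(u):=\frac{(v_1-v_1(z_i))^{\beta_1}\cdots(v_m-v_m(z_i))^{\beta_m}}{\beta_1!\cdots\beta_m!}\,g_i(u),\quad \beta\in\Delta_i,\ 1\le i\le n.$$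
   Context: Setting: $\mathcal{M}\subset\mathbb{R}^{d+1}$, $d\ge 2$, is an $m$-dimensional Riemannian manifold, $U\subset\mathcal{M}$ is an open set (in $\mathcal{M}$), and $\varphi:U\to\mathbb{R}^m$ maps $U$ homeomorphically onto the open set $V=\varphi(U)\subset\mathbb{R}^m$. For $u\in U$ write $v=v(u)=\varphi(u)=(v_1(u),\ldots,v_m(u))$ for its local coordinates. $\mathcal{X}=\{z_1,\ldots,z_n\}\subset U$ is a set of distinct points, possibly scattered, with associated finite sets of multi-indices $\Delta_1,\ldots,\Delta_n\subset\mathbb{N}_0^m$. For $\beta=(\beta_1,\ldots,\beta_m)$ put $|\beta|=\beta_1+\cdots+\beta_m$, and let $k=\max\{|\beta|:\beta\in\Delta_i\text{ for some }i,\ 1\le i\le n\}$. A function $F:U\to\mathbb{R}$ is in $C^k(U)$ if $F\circ\varphi^{-1}\in C^k(V)$, and derivatives are taken in the local coordinates: $D^\beta F(z):=\dfrac{\partial^{|\beta|}(F\circ\varphi^{-1})}{\partial v_1^{\beta_1}\cdots\partial v_m^{\beta_m}}(\varphi(z))$ for $z\in U$, $|\beta|\le k$. Cardinal basis functions: functions $g_1,\ldots,g_n:U\to\mathbb{R}$ are cardinal basis functions with respect to $\mathcal{X}$ if $g_j\in C^k(U)$, $g_j(u)\ge 0$ and $\sum_{j=1}^n g_j(u)=1$ for all $u\in U$, $g_j(z_i)=\delta_{ji}$ (Kronecker delta) for all $i,j$, and they also satisfy the additional property $$D^\beta g_j(z_i)=0,\qquad \beta\in\Delta_i,\ |\beta|\ne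 0,\quad i=1,\ldots,n,$$ for every $j=1,\ldots,n$.
   Formalization: The condition D^β H(z_i)=D^β f(z_i) is asserted only if D^e g_j(z_i)=0 for all j and all e≤β with e∉Δ_i, |e|≥2 (automatic if Δ_i is downward closed or |β|≤2); as stated it fails, e.g. m=1, z=0,1, Δ_1={3}, Δ_2={1}, g_1=cos²(πv/2), g_2=sin²(πv/2), f=v. *)

(* Defs.v *)
From HB Require Import structures.
From mathcomp Require Import all_boot all_order all_algebra finmap.
From mathcomp Require Import all_classical all_reals topology normedtype derive.
Set Implicit Arguments.
Unset Strict Implicit.
Unset Printing Implicit Defensive.
Import Order.TTheory GRing.Theory Num.Theory.
Import numFieldNormedType.Exports.
Local Open Scope classical_set_scope.
Local Open Scope ring_scope.

Definition mindex (m : nat) := {ffun 'I_m -> nat}.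

Definition mindex_deg (m : nat) (b : mindex m) : nat := (\sum_(a < m) b a)%N.

Definition mindex_fact (m : nat) (b : mindex m) : nat := (\prod_(a < m) (b a)`!)%N.

Definition mindex_le (m : nat) (c b : mindex m) : Prop :=
  forall a : 'I_m, (c a <= b a)%N.

Definition monomial (R : realType) (m : nat) (b : mindex m) (x : 'rV[R]_m) : R :=
  \prod_(a < m) x 0 a ^+ b a.

Section EuclideanCalculus.
Context {R : realType} {m : nat}.
Implicit Types (F : 'rV[R]_m -> R) (V : set 'rV[R]_m).

Definition partial (a : 'I_m) F : 'rV[R]_m -> R :=
  fun v => 'D_(delta_mx 0 a) F v.

(* d^|b| F / dv_1^(b_1) ... dv_m^(b_m): the last variable is differentiated
   first.  On C^|b| functions the order is immaterial. *)
Definition mpartial (b : mindex m) F : 'rV[R]_m -> R :=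
  foldr (fun a G => iter (b a) (partial a) G) F (enum 'I_m).

(* F is C^k on the open set V.  F is a total function, but its values off V
   are irrelevant because V is open. *)
Fixpoint Ck (k : nat) V F : Prop :=
  (forall v, V v -> {for v, continuous F}) /\
  match k with
  | 0%N => True
  | k'.+1 => forall a : 'I_m,
      (forall v, V v -> derivable F v (delta_mx 0 a)) /\ Ck k' V (partial a F)
  end.

End EuclideanCalculus.

(* A coordinate patch (U, phi) in R^(d+1), together with the inverse of phi.
   The maps are total; only fwd on dom and bwd on coords matter. *)
Record coord_patch (R : realType) (d m : nat) := CoordPatch {
  dom : set 'rV[R]_d.+1 ;
  fwd : 'rV[R]_d.+1 -> 'rV[R]_m ;
  bwd : 'rV[R]_m -> 'rV[R]_d.+1 }.

Definition coords (R : realType) (d m : nat) (c : coord_patch R d m) : set 'rV[R]_m :=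
  fwd c @` dom c.

(* fwd c maps dom c, open in M for the subspace topology, homeomorphically
   onto the open set coords c. *)
Record is_chart (R : realType) (d m : nat) (M : set 'rV[R]_d.+1)
    (c : coord_patch R d m) : Prop := IsChart {
  chart_dom_open : exists2 O : set 'rV[R]_d.+1, open O & dom c = M `&` O ;
  chart_coords_open : open (coords c) ;
  chart_fwdK : forall u, dom c u -> bwd c (fwd c u) = u ;
  chart_fwd_continuous : {within dom c, continuous (fwd c)} ;
  chart_bwd_continuous : {within coords c, continuous (bwd c)} }.

Definition transition (R : realType) (d m : nat) (c c' : coord_patch R d m)
  : 'rV[R]_m -> 'rV[R]_m := fwd c' \o bwd c.

Definition overlap (R : realType) (d m : nat) (c c' : coord_patch R d m)
  : set 'rV[R]_m := fwd c @` (dom c `&` dom c').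

(* An m-dimensional Riemannian structure on the topological subspace M of
   R^(d+1): a smooth atlas and a smooth metric tensor, given in each chart by
   its Gram matrix.  Neither the smooth structure nor the metric is required to
   be the one induced by the ambient space.  The manifold is automatically
   Hausdorff and second countable. *)
Record riemannian_structure (R : realType) (d m : nat) (M : set 'rV[R]_d.+1) :=
  RiemannianStructure {
  atlas : set (coord_patch R d m) ;
  metric : coord_patch R d m -> 'rV[R]_m -> 'M[R]_m ;
  atlas_chart : forall c, atlas c -> is_chart M c ;
  atlas_cover : forall p, M p -> exists2 c, atlas c & dom c p ;
  atlas_smooth : forall c c', atlas c -> atlas c' -> forall (k : nat) (a : 'I_m),
    Ck k (overlap c c') (fun v => transition c c' v 0 a) ;
  metric_smooth : forall c, atlas c -> forall (k : nat) (a b : 'I_m),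
    Ck k (coords c) (fun v => metric c v a b) ;
  metric_symmetric : forall c v, atlas c -> coords c v -> (metric c v)^T = metric c v ;
  metric_posdef : forall c v, atlas c -> coords c v ->
    forall x : 'rV[R]_m, x != 0 -> 0 < (x *m metric c v *m x^T) 0 0 ;
  metric_transition : forall c c' v, atlas c -> atlas c' -> overlap c c' v ->
    let J : 'M[R]_m :=
      \matrix_(a, b) partial a (fun w => transition c c' w 0 b) v in
    metric c v = J *m metric c' (transition c c' v) *m J^T }.

Section HermiteBirkhoff.
Context {R : realType} {d m : nat}.
Variable c : coord_patch R d m.
Implicit Types (F : 'rV[R]_d.+1 -> R) (u p : 'rV[R]_d.+1) (b : mindex m).

Definition CkU (k : nat) F : Prop := Ck k (coords c) (F \o bwd c).

Definition Dloc b F p : R := mpartial b (F \o bwd c) (fwd c p).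

Variables (n : nat) (z : 'I_n -> 'rV[R]_d.+1) (Delta : 'I_n -> {fset mindex m}).

Definition max_order : nat :=
  (\max_(i < n) \max_(b <- Delta i) mindex_deg b)%N.

Record cardinal_basis (g : 'I_n -> 'rV[R]_d.+1 -> R) : Prop := CardinalBasis {
  cardinal_Ck : forall j, CkU max_order (g j) ;
  cardinal_ge0 : forall j u, dom c u -> 0 <= g j u ;
  cardinal_sum1 : forall u, dom c u -> \sum_(j < n) g j u = 1 ;
  cardinal_delta : forall i j, g j (z i) = (j == i)%:R ;
  cardinal_flat : forall i j b, b \in Delta i -> mindex_deg b != 0%N ->
    Dloc b (g j) (z i) = 0 }.

(* The g_j are also flat at z_i in those orders e <= b of total degree at least
   2 that are missing from Delta_i.  This holds vacuously when Delta_i contains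
   every such e, e.g. if Delta_i is downward closed or has degree at most 2.

   Being cardinal does not suffice for D^b H(z_i) = D^b f(z_i) if b in Delta_i
   has a gap below it.  Take m = 1 and a line with coordinate v, z_1 = 0,
   z_2 = 1, Delta_1 = {3}, Delta_2 = {1}, g_1 = cos^2(pi v / 2),
   g_2 = sin^2(pi v / 2), f = v.  Then g_1, g_2 are cardinal,
   H = (v - 1) sin^2(pi v / 2), and H'''(0) = 3 pi^2 / 2, but f'''(0) = 0:
   the Leibniz rule brings in g_2''(0), and 2 is not in Delta_1.
   Gaps of degree 1 are harmless, since each g_j has an extremum at z_i. *)
Definition flat_in_gaps (g : 'I_n -> 'rV[R]_d.+1 -> R) (i : 'I_n) b : Prop :=
  forall (j : 'I_n) (e : mindex m),
    mindex_le e b -> e \notin Delta i -> (1 < mindex_deg e)%N ->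
    Dloc e (g j) (z i) = 0.

Variables (f : 'rV[R]_d.+1 -> R) (g : 'I_n -> 'rV[R]_d.+1 -> R).

Definition taylor (i : 'I_n) u : R :=
  \sum_(b <- Delta i)
    Dloc b f (z i) / (mindex_fact b)%:R * monomial b (fwd c u - fwd c (z i)).

Definition interpolant u : R := \sum_(i < n) taylor i u * g i u.

Definition hermite_basis (i : 'I_n) b u : R :=
  monomial b (fwd c u - fwd c (z i)) / (mindex_fact b)%:R * g i u.

End HermiteBirkhoff.

(* Main.v *)
Require Import Defs.
From HB Require Import structures.
From mathcomp Require Import all_boot all_order all_algebra finmap.
From mathcomp Require Import all_classical all_reals topology normedtype derive.

(** In coordinates [H = \sum_j T_j * G_j] with [T_j] a polynomial and [G_j] the
    local expression of [g j].  At [z i] every mixed partial of [G_j] of a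
    nonzero order [e <= b] vanishes: by flatness if [e] lies in [Delta i], by
    hypothesis if [e] is a gap of degree at least 2, and because [G_j] has an
    extremum at [z i] if [e] is a gap of degree 1.  The Leibniz rule thus gives
    [D^b (T_j * G_j) = D^b T_j * G_j] there, so only [D^b T_i] survives, and it
    is [D^b f].  A mixed partial is handled as the derivative along a sorted
    word of variables: the subwords occurring in the Leibniz rule are sorted
    again, hence mixed partials themselves, and the symmetry of second
    derivatives is never invoked. *)

Set Implicit Arguments.
Unset Strict Implicit.
Unset Printing Implicit Defensive.
Import Order.TTheory GRing.Theory Num.Theory.
Import numFieldNormedType.Exports.
Local Open Scope classical_set_scope.
Local Open Scope ring_scope.

Section Calculus.
Context {R : realType} {m : nat}.
Implicit Types (F G : 'rV[R]_m -> R) (V : set 'rV[R]_m) (w s : seq 'I_m).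

(** * C^k functions on an open set: locality, sums, products, powers *)

Lemma open_eq_near V F G v : open V -> (forall x, V x -> F x = G x) -> V v ->
  {near v, F =1 G}.
Proof.
move=> oV FG Vv; apply: filterS (open_nbhs_nbhs (conj oV Vv)) => x Vx.
exact: FG.
Qed.

Lemma eq_partial V F G a : open V -> (forall x, V x -> F x = G x) ->
  forall v, V v -> partial a F v = partial a G v.
Proof. by move=> oV FG v Vv; exact/near_eq_derive/(open_eq_near oV). Qed.

Lemma eq_continuous V F G v : open V -> (forall x, V x -> F x = G x) -> V v ->
  {for v, continuous F} -> {for v, continuous G}.
Proof.
move=> oV FG Vv cF; apply: cvg_trans (near_eq_cvg (open_eq_near oV FG Vv)) _.
by rewrite -FG.
Qed.

(** Continuity and derivability at a point of the open set [V] depend only on nearby values, and the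
    partials of [F] and [G] agree on [V] again. This carries the sum and product rules, established
    pointwise on [V], to higher orders. *)
Lemma eq_Ck k V F G : open V -> (forall x, V x -> F x = G x) ->
  Ck k V F -> Ck k V G.
Proof.
elim: k F G => [|k IHk] F G oV FG [cF dF]; split=> //.
- by move=> v Vv; exact: eq_continuous oV FG Vv (cF v Vv).
- by move=> v Vv; exact: eq_continuous oV FG Vv (cF v Vv).
- move=> a; have [dFa CFa] := dF a; split=> [v Vv|].
    exact: near_eq_derivable (open_eq_near oV FG Vv) (dFa v Vv).
  exact: IHk oV (eq_partial a oV FG) CFa.
Qed.

Lemma Ck_continuous k V F v : Ck k V F -> V v -> {for v, continuous F}.
Proof. by case: k => [|k] [cF _] Vv; exact: cF. Qed.

Lemma CkW k V F : Ck k.+1 V F -> Ck k V F.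
Proof.
elim: k F => [|k IHk] F [cF dF]; split=> // a.
by have [dFa CFa] := dF a; split=> //; exact: IHk.
Qed.

Lemma Ck_leq k l V F : (k <= l)%N -> Ck l V F -> Ck k V F.
Proof.
move=> /subnK <-; elim: (l - k)%N => [|n IHn]; first by rewrite add0n.
by rewrite addSn => /CkW.
Qed.

Lemma derive_cst0 (x : R) (v e : 'rV[R]_m) : 'D_e (fun=> x) v = 0 :> R.
Proof. exact: derive_cst. Qed.

Lemma Ck_cst k V (x : R) : Ck k V (fun=> x).
Proof.
elim: k x => [|k IHk] x; split=> //; [by move=> v _; exact: cst_continuous..|].
move=> a; split=> [v _|]; first exact: derivable_cst.
suff -> : partial a (fun=> x) = fun=> 0 by [].
by apply/funext => v; exact: derive_cst0.
Qed.

Lemma partialD V F G a v : Ck 1 V F -> Ck 1 V G -> V v ->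
  partial a (fun x => F x + G x) v = partial a F v + partial a G v.
Proof. by move=> [_ dF] [_ dG] Vv; apply: deriveD; [apply: (dF a).1|apply: (dG a).1]. Qed.

Lemma partialM V F G a v : Ck 1 V F -> Ck 1 V G -> V v ->
  partial a (fun x => F x * G x) v = partial a F v * G v + F v * partial a G v.
Proof.
move=> [_ dF] [_ dG] Vv.
apply: etrans (deriveM ((dF a).1 v Vv) ((dG a).1 v Vv)) _.
by rewrite addrC; congr (_ + _); exact: mulrC.
Qed.

Lemma CkD k V F G : open V -> Ck k V F -> Ck k V G ->
  Ck k V (fun x => F x + G x).
Proof.
move=> oV; elim: k F G => [|k IHk] F G CF CG; split=> //.
- by move=> v Vv; apply: continuousD; [exact: Ck_continuous CF Vv|exact: Ck_continuous CG Vv].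
- by move=> v Vv; apply: continuousD; [exact: Ck_continuous CF Vv|exact: Ck_continuous CG Vv].
- move=> a; have [dFa CFa] := CF.2 a; have [dGa CGa] := CG.2 a; split=> [v Vv|].
    by apply: derivableD; [exact: dFa|exact: dGa].
  apply: eq_Ck oV _ (IHk _ _ CFa CGa) => x Vx.
  symmetry; apply: partialD Vx; [exact: Ck_leq CF|exact: Ck_leq CG].
Qed.

Lemma CkM k V F G : open V -> Ck k V F -> Ck k V G ->
  Ck k V (fun x => F x * G x).
Proof.
move=> oV; elim: k F G => [|k IHk] F G CF CG; split=> //.
- by move=> v Vv; apply: continuousM; [exact: Ck_continuous CF Vv|exact: Ck_continuous CG Vv].
- by move=> v Vv; apply: continuousM; [exact: Ck_continuous CF Vv|exact: Ck_continuous CG Vv].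
- move=> a; have [dFa CFa] := CF.2 a; have [dGa CGa] := CG.2 a; split=> [v Vv|].
    by apply: derivableM; [exact: dFa|exact: dGa].
  have CFG : Ck k V (fun x => partial a F x * G x + F x * partial a G x).
    by apply: CkD => //; apply: IHk => //; exact: CkW.
  apply: eq_Ck oV _ CFG => x Vx.
  symmetry; apply: partialM Vx; [exact: Ck_leq CF|exact: Ck_leq CG].
Qed.

Lemma Ck_sum (I : Type) (r : seq I) k V (Fs : I -> 'rV[R]_m -> R) : open V ->
  (forall i, Ck k V (Fs i)) -> Ck k V (fun x => \sum_(i <- r) Fs i x).
Proof.
move=> oV CFs; elim: r => [|i r IHr].
  by apply: eq_Ck oV _ (Ck_cst _ _ 0) => x _; rewrite big_nil.
by apply: eq_Ck oV _ (CkD oV (CFs i) IHr) => x _; rewrite big_cons.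
Qed.

Lemma Ck_prod (I : Type) (r : seq I) k V (Fs : I -> 'rV[R]_m -> R) : open V ->
  (forall i, Ck k V (Fs i)) -> Ck k V (fun x => \prod_(i <- r) Fs i x).
Proof.
move=> oV CFs; elim: r => [|i r IHr].
  by apply: eq_Ck oV _ (Ck_cst _ _ 1) => x _; rewrite big_nil.
by apply: eq_Ck oV _ (CkM oV (CFs i) IHr) => x _; rewrite big_cons.
Qed.

Lemma CkX k V F n : open V -> Ck k V F -> Ck k V (fun x => F x ^+ n).
Proof.
move=> oV CF; elim: n => [|n IHn].
  by apply: eq_Ck oV _ (Ck_cst _ _ 1) => x _; rewrite expr0.
by apply: eq_Ck oV _ (CkM oV CF IHn) => x _; rewrite exprS.
Qed.

(** * Coordinate functions and monomials are C^k *)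

Lemma is_derive_coord (v e : 'rV[R]_m) (i : 'I_m) (y : R) :
  is_derive v e (fun x : 'rV[R]_m => x 0 i - y : R) (e 0 i).
Proof.
(* The difference quotient of an affine function is constant for [h != 0]. *)
have lime : (fun h : R => h^-1 *: ((h *: e + v) 0 i - y - (v 0 i - y))) @ 0^'
    --> (e 0 i : R).
  apply: cvg_near_cst; near=> h; have h0 : h != 0 by near: h; exact: nbhs_dnbhs_neq.
  rewrite !mxE opprB addrA subrK addrK; exact: mulKf.
split; [exact: cvgP lime|exact: cvg_lim lime].
Unshelve. all: by end_near. Qed.

Lemma partial_coord (a i : 'I_m) (y : R) :
  partial a (fun x : 'rV[R]_m => x 0 i - y) = fun=> (i == a)%:R.
Proof.
apply/funext => v; rewrite /partial.
by have [_ ->] := is_derive_coord v (delta_mx 0 a) i y; rewrite mxE.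
Qed.

Lemma Ck_coord k V (i : 'I_m) (y : R) :
  Ck k V (fun x : 'rV[R]_m => x 0 i - y).
Proof.
have cc v : {for v, continuous (fun x : 'rV[R]_m => x 0 i - y : R)}.
  by apply: continuousB; [exact: coord_continuous|exact: cst_continuous].
elim: k => [|k IHk]; split=> // a; split=> [v _|].
  by have [] := is_derive_coord v (delta_mx 0 a) i y.
by rewrite partial_coord; exact: Ck_cst.
Qed.

Lemma Ck_monomial k V (b : mindex m) (y : 'rV[R]_m) : open V ->
  Ck k V (fun x => monomial b (x - y)).
Proof.
move=> oV; have C := Ck_prod (index_enum 'I_m) oV
  (fun a => CkX (b a) oV (Ck_coord k V a (y 0 a))).
apply: eq_Ck oV _ C => x _; rewrite /monomial.
by apply: eq_bigr => a _; rewrite !mxE.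
Qed.

(** * Iterated derivatives along words of variables *)

Definition deriv_word w F : 'rV[R]_m -> R := foldr (@partial R m) F w.

Lemma deriv_word_rcons w a F :
  deriv_word (rcons w a) F = deriv_word w (partial a F).
Proof. exact: foldr_rcons. Qed.

Lemma eq_deriv_word V w F G : open V -> (forall x, V x -> F x = G x) ->
  forall v, V v -> deriv_word w F v = deriv_word w G v.
Proof. by move=> oV FG; elim: w => [|a w IHw] //=; exact: eq_partial. Qed.

Lemma deriv_word_cst0 w : deriv_word w (fun=> 0) = fun=> 0.
Proof.
elim: w => [|a w /= ->] //; apply/funext => v; exact: derive_cst0.
Qed.

(** The last letter of a word acts first on the function, and [Ck] unfolds to a condition on exactly
    this innermost derivative. Induction therefore removes letters from the right. *)
Lemma deriv_wordD V w F G v : open V -> Ck (size w) V F -> Ck (size w) V G ->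
  V v -> deriv_word w (fun x => F x + G x) v =
         deriv_word w F v + deriv_word w G v.
Proof.
move=> oV; elim/last_ind: w F G => [|w a IHw] F G //.
rewrite size_rcons => CF CG Vv; rewrite !deriv_word_rcons.
rewrite -(IHw _ _ (CF.2 a).2 (CG.2 a).2 Vv).
apply: eq_deriv_word oV _ _ Vv => x Vx.
by apply: partialD Vx; [exact: Ck_leq CF|exact: Ck_leq CG].
Qed.

Lemma deriv_word_sum (I : Type) (r : seq I) V w (Fs : I -> 'rV[R]_m -> R) v :
  open V -> (forall i, Ck (size w) V (Fs i)) -> V v ->
  deriv_word w (fun x => \sum_(i <- r) Fs i x) v =
  \sum_(i <- r) deriv_word w (Fs i) v.
Proof.
move=> oV CFs Vv; elim: r => [|i r IHr].
  (* The right-hand 0 is written as the derivative of the zero function, so that both sides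
     differentiate functions that agree on [V]. *)
  rewrite big_nil -[RHS](congr1 (@^~ v) (deriv_word_cst0 w)).
  by apply: eq_deriv_word oV _ _ Vv => x _; rewrite big_nil.
rewrite big_cons -IHr -(deriv_wordD oV)//; last exact: Ck_sum.
by apply: eq_deriv_word oV _ _ Vv => x _; rewrite big_cons.
Qed.

(* Differentiating the product once leaves [partial a F * G], to which induction
   applies, and [F * partial a G], whose second factor is flat in every
   subword, the empty one included. *)
Lemma deriv_wordM_flat V w F G v : open V ->
  Ck (size w) V F -> Ck (size w) V G -> V v ->
  (forall s, subseq s w -> s != [::] -> deriv_word s G v = 0) ->
  deriv_word w (fun x => F x * G x) v = deriv_word w F v * G v.
Proof.
move=> oV; elim/last_ind: w F G => [|w a IHw] F G //.
rewrite size_rcons => CF CG Vv flat; rewrite !deriv_word_rcons.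
have [CaF CaG] := ((CF.2 a).2, (CG.2 a).2).
have [CF1 CG1] := (CkW CF, CkW CG).
have subw s : subseq s w -> subseq s (rcons w a).
  by move=> sw; exact: subseq_trans sw (subseq_rcons w a).
transitivity (deriv_word w (fun x => partial a F x * G x + F x * partial a G x) v).
  apply: eq_deriv_word oV _ _ Vv => x Vx.
  by apply: partialM Vx; [exact: Ck_leq CF|exact: Ck_leq CG].
rewrite (deriv_wordD oV) ?[X in _ + X]IHw ?IHw//; try exact: CkM.
- rewrite (_ : partial a G v = 0) ?mulr0 ?addr0//.
  by apply: (flat [:: a]) => //; rewrite sub1seq mem_rcons mem_head.
- by move=> s /subw; exact: flat.
- move=> s sw _; rewrite -deriv_word_rcons; apply: flat.
    by rewrite -!cats1 cat_subseq.
  by rewrite -size_eq0 size_rcons.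
Qed.

(** * First partials at an extremum, by restriction to a line *)

Lemma line_growth F (e v : 'rV[R]_m) (t : R) :
  let L := fun h : R => F (h *: e + v) in
  (fun h => h^-1 *: ((L \o shift t) (h *: 1) - L t)) =
  (fun h => h^-1 *: ((F \o shift (t *: e + v)) (h *: e) - F (t *: e + v))).
Proof.
apply/funext => h /=; congr (_ *: (F _ - _)).
by rewrite [h *: 1]mulr1 scalerDl addrA.
Qed.

(** The restriction [L] of [F] to the line through [v] in direction [e] has an extremum at 0 on an
    interval []- r, r[] that the line maps into [V], so the one-variable criterion applies. By
    [line_growth] the difference quotients of [L] and [F] coincide, hence so do derivability and
    derivatives. *)
Lemma partial_extremum V F a v : open V -> Ck 1 V F -> V v ->
  (forall x, V x -> F v <= F x) \/ (forall x, V x -> F x <= F v) ->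
  partial a F v = 0.
Proof.
move=> oV [_ /(_ a)[dF _]] Vv ext; set e := delta_mx 0 a in dF.
pose L := fun h : R => F (h *: e + v).
have nV : nbhs (0 : R) [set h | V (h *: e + v)].
  have cl : {for (0 : R), continuous (fun h : R => h *: e + v)}.
    apply: continuousD; last exact: cst_continuous.
    exact: scalel_continuous.
  by apply: cl; rewrite scale0r add0r; exact: open_nbhs_nbhs.
have [r r0 Vr] := proj1 (nbhs_ballP _ _) nV.
have {}Vr t : t \in `]- r, r[ -> V (t *: e + v).
  by rewrite in_itv/= => tr; apply: Vr; rewrite /ball /= sub0r normrN ltr_norml.
have r_le : - r <= r by rewrite ge0_cp// ltW.
have z_in : (0 : R) \in `]- r, r[ by rewrite in_itv/= oppr_lt0 r0.
have dL t : t \in `]- r, r[ -> derivable L t 1.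
  by move=> /Vr/dF; rewrite /derivable line_growth.
have L0 : L 0 = F v by rewrite /L scale0r add0r.
have -> : partial a F v = 'D_1 L 0.
  by rewrite /partial /derive line_growth scale0r add0r.
have [] : is_derive (0 : R) 1 L 0 => //.
case: ext => ext.
  by apply: derive1_at_min r_le dL z_in _ => t /Vr Vt; rewrite L0; exact: ext.
by apply: derive1_at_max r_le dL z_in _ => t /Vr Vt; rewrite L0; exact: ext.
Qed.

(** * Derivatives of monomials *)

Lemma partial_invariant F a v :
  (forall h, F (h *: delta_mx 0 a + v) = F v) -> partial a F v = 0.
Proof.
move=> inv; apply: cvg_lim => //; apply: cvg_near_cst.
by apply: nearW => h; rewrite /= inv subrr scaler0.
Qed.

Lemma partial_coordX (a : 'I_m) (y : R) n (x : 'rV[R]_m) :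
  partial a (fun x : 'rV[R]_m => (x 0 a - y) ^+ n) x =
  n%:R * (x 0 a - y) ^+ n.-1.
Proof.
elim: n => [|n IHn]; first by rewrite mul0r; exact: derive_cst0.
transitivity (partial a (fun x : 'rV[R]_m => (x 0 a - y) * (x 0 a - y) ^+ n) x).
  by apply: (eq_partial _ openT) => // t _; rewrite exprS.
rewrite (@partialM setT)//; first last.
- by apply: CkX; [exact: openT|exact: Ck_coord].
- exact: Ck_coord.
rewrite partial_coord /= eqxx mulr1n mul1r IHn mulrS [RHS]mulrDl [in RHS]mul1r.
(* The identity [t * t ^+ n.-1 = t ^+ n] breaks down at [n = 0], where the coefficient [n%:R] is
   0. *)
congr (_ + _); case: n {IHn} => [|n]; first by rewrite !mul0r mulr0.
by rewrite mulrCA -exprS.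
Qed.

Lemma monomial_split (a : 'I_m) (e : mindex m) (x : 'rV[R]_m) :
  monomial e x =
  x 0 a ^+ e a * monomial [ffun i => if i == a then 0%N else e i] x.
Proof.
rewrite /monomial (bigD1 a)//= [in RHS](bigD1 a)//= ffunE eqxx expr0 mul1r.
by congr (_ * _); apply: eq_bigr => i /negPf ia; rewrite ffunE ia.
Qed.

(** The power of variable [a] is split off; the remaining factor is constant in direction [a], so
    the product rule leaves one term. If [e a = 0], the exponent is truncated to 0, but then the
    coefficient [(e a)%:R] vanishes. *)
Lemma partial_monomial (a : 'I_m) (K : R) (e : mindex m) (y : 'rV[R]_m) :
  partial a (fun x => K * monomial e (x - y)) =
  fun x => K * (e a)%:R * monomial [ffun i => (e i - (i == a))%N : nat] (x - y).
Proof.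
apply/funext => x; set e0 : mindex m := [ffun i => if i == a then 0%N else e i].
pose G := fun x : 'rV[R]_m => K * monomial e0 (x - y).
pose P := fun x : 'rV[R]_m => (x 0 a - y 0 a) ^+ e a.
have CP : Ck 1 setT P by apply: CkX; [exact: openT|exact: Ck_coord].
have CG : Ck 1 setT G.
  apply: CkM; [exact: openT|exact: Ck_cst|apply: Ck_monomial; exact: openT].
transitivity (partial a (fun x => P x * G x) x).
  apply: (eq_partial _ openT) => // t _.
  by rewrite (monomial_split a) mulrCA !mxE.
rewrite (partialM _ CP CG)// partial_coordX [X in _ + _ * X]partial_invariant.
  rewrite mulr0 addr0 /G (monomial_split a [ffun i => _]) !mxE ffunE eqxx subn1.
  rewrite [_ * (K * _)]mulrCA !mulrA; congr (_ * _ * monomial _ _); last first.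
    by apply/ffunP => i; rewrite !ffunE; case: eqP => // _; rewrite subn0.
move=> h; rewrite /G; congr (_ * _); apply: eq_bigr => i _.
rewrite ffunE; case: eqP => [_|/eqP ia]; first by rewrite !expr0.
by rewrite !mxE (negPf ia) andbF mulr0 add0r.
Qed.

(** Only the number of occurrences of each letter matters. Where an exponent is truncated because
    [count_mem a w] exceeds [e a], the falling factorial is 0. *)
Lemma deriv_word_monomial w (K : R) (e : mindex m) (y : 'rV[R]_m) :
  deriv_word w (fun x => K * monomial e (x - y)) =
  fun x => K * (\prod_(a < m) (e a) ^_ (count_mem a w))%:R *
           monomial [ffun a => (e a - count_mem a w)%N : nat] (x - y).
Proof.
elim: w => [|a w /= ->].
  apply/funext => x /=; rewrite big1 ?mulr1; last by move=> a _; rewrite ffactn0.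
  by congr (_ * monomial _ _); apply/ffunP => a; rewrite ffunE subn0.
rewrite partial_monomial; apply/funext => x.
rewrite -!mulrA; congr (_ * _); rewrite mulrA -natrM ffunE.
congr (_ * _); last first.
  by congr (monomial _ _); apply/ffunP => i; rewrite !ffunE -subnDA addnC eq_sym.
congr (_%:R).
(* The new letter [a] contributes [e a - count_mem a w], the next factor of the falling
   factorial. *)
rewrite (bigD1 a)//= [in RHS](bigD1 a)//= eqxx add1n ffactnSr.
rewrite mulnAC; congr (_ * _)%N; apply: eq_bigr => i /negPf ia.
by rewrite eq_sym ia.
Qed.

(** * Multi-indices as sorted words *)

Definition mindex_word (b : mindex m) : seq 'I_m :=
  flatten [seq nseq (b a) a | a <- enum 'I_m].

Lemma mpartialE (b : mindex m) F : mpartial b F = deriv_word (mindex_word b) F.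
Proof.
rewrite /mpartial /mindex_word /deriv_word; elim: (enum 'I_m) => //= a r ->.
by rewrite foldr_cat; elim: (b a) => //= n ->.
Qed.

Lemma size_mindex_word (b : mindex m) : size (mindex_word b) = mindex_deg b.
Proof.
rewrite size_flatten sumnE 2!big_map big_enum /=.
by apply: eq_bigr => a _; rewrite size_nseq.
Qed.

Lemma count_mindex_word (b : mindex m) a : count_mem a (mindex_word b) = b a.
Proof.
rewrite count_flatten sumnE 2!big_map big_enum (bigD1 a)//= count_nseq/= eqxx mul1n.
by rewrite big1 ?addn0// => i /negPf ia; rewrite count_nseq/= ia.
Qed.

(** By transitivity sortedness is a pairwise condition, and that form splits over concatenation:
    each block is constant, and letters increase from one block to the next. *)
Lemma mindex_word_sorted (b : mindex m) :
  sorted (relpre val leq) (mindex_word b).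
Proof.
have tr : transitive (relpre (val : 'I_m -> nat) leq).
  by move=> x y t; exact: leq_trans.
rewrite sorted_pairwise//.
have : pairwise (relpre val leq) (enum 'I_m).
  rewrite -sorted_pairwise// -sorted_map val_enum_ord.
  exact: iota_sorted.
rewrite /mindex_word; elim: (enum 'I_m) => //= a r IHr /andP[ar /IHr pr].
rewrite pairwise_cat pr andbT; apply/andP; split.
  apply/allrelP => x t; rewrite mem_nseq => /andP[_ /eqP ->].
  move=> /flatten_mapP[i ir]; rewrite mem_nseq => /andP[_ /eqP ->].
  exact: (allP ar).
by elim: (b a) => //= n ->; rewrite all_nseq/= leqnn orbT.
Qed.

(** Both words are sorted and contain each letter equally often, and the order on letters is
    antisymmetric. *)
Lemma subseq_mindex_word (b : mindex m) s : subseq s (mindex_word b) ->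
  s = mindex_word [ffun a => count_mem a s].
Proof.
move=> sb; apply: (@sorted_eq _ (relpre val leq)).
- by move=> x y t; exact: leq_trans.
- by move=> x y xy; apply/val_inj/anti_leq.
- apply: subseq_sorted sb (mindex_word_sorted b).
  by move=> x y t; exact: leq_trans.
- exact: mindex_word_sorted.
- by apply/allP => x _ /=; rewrite count_mindex_word ffunE.
Qed.

(** If [e a < b a] for some [a], the falling factorial vanishes; if [e a > b a], a positive power of
    0 remains at the center [y]. For [e = b] all exponents drop to 0 and the falling factorials are
    full factorials. *)
Lemma mpartial_monomial (b e : mindex m) (K : R) (y : 'rV[R]_m) :
  mpartial b (fun x => K * monomial e (x - y)) y =
  if e == b then K * (mindex_fact b)%:R else 0.
Proof.
rewrite mpartialE deriv_word_monomial subrr.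
have [->|/eqP neb] := eqVneq e b.
  rewrite [monomial _ _]big1 => [|a _]; last first.
    by rewrite ffunE count_mindex_word subnn.
  rewrite mulr1; congr (_ * _%:R); apply: eq_bigr => a _.
  by rewrite count_mindex_word ffactnn.
have [a eba] : exists a, e a != b a.
  apply/existsP; apply: contra_notT neb; rewrite negb_exists => /forallP eb.
  by apply/ffunP => a; apply/eqP; rewrite -[_ == _]negbK.
have [lt_eb|] := ltnP (e a) (b a).
  by rewrite (bigD1 a)//= count_mindex_word ffact_small// mul0n mulr0 mul0r.
rewrite leq_eqVlt eq_sym (negPf eba)/= => lt_be.
rewrite [monomial _ _](bigD1 a)//= ffunE count_mindex_word mxE expr0n.
by rewrite subn_eq0 leqNgt lt_be mul0r mulr0.
Qed.

Lemma mpartialM_flat V (b : mindex m) F G v : open V ->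
  Ck (mindex_deg b) V F -> Ck (mindex_deg b) V G -> V v ->
  (forall e, mindex_le e b -> mindex_deg e != 0%N -> mpartial e G v = 0) ->
  mpartial b (fun x => F x * G x) v = mpartial b F v * G v.
Proof.
rewrite -size_mindex_word => oV CF CG Vv flat; rewrite !mpartialE.
apply: deriv_wordM_flat oV CF CG Vv _ => s sb s0.
have sE := subseq_mindex_word sb; rewrite sE -mpartialE; apply: flat.
  by move=> a; rewrite ffunE -(count_mindex_word b) leq_count_subseq.
by rewrite -size_mindex_word -sE size_eq0.
Qed.

Lemma mindex_deg1 (e : mindex m) : mindex_deg e = 1%N ->
  exists a, forall F, mpartial e F = partial a F.
Proof.
rewrite -size_mindex_word; case E : (mindex_word e) => [|a [|//]] // _.
by exists a => F; rewrite mpartialE E.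
Qed.

Lemma eq_mpartial V (b : mindex m) F G : open V ->
  (forall x, V x -> F x = G x) -> forall v, V v -> mpartial b F v = mpartial b G v.
Proof. by move=> oV FG v Vv; rewrite !mpartialE; exact: eq_deriv_word Vv. Qed.

Lemma mpartial_sum (I : Type) (r : seq I) V (b : mindex m)
    (Fs : I -> 'rV[R]_m -> R) v :
  open V -> (forall i, Ck (mindex_deg b) V (Fs i)) -> V v ->
  mpartial b (fun x => \sum_(i <- r) Fs i x) v =
  \sum_(i <- r) mpartial b (Fs i) v.
Proof.
rewrite -size_mindex_word mpartialE => oV CFs Vv.
rewrite (deriv_word_sum _ oV CFs Vv).
by apply: eq_bigr => i _; rewrite mpartialE.
Qed.

End Calculus.

(** * The interpolant in local coordinates *)

Section Interpolation.
Context {R : realType} {d m : nat} (M : set 'rV[R]_d.+1) (c : coord_patch R d m).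
Hypothesis hc : is_chart M c.
Context (n : nat) (z : 'I_n -> 'rV[R]_d.+1) (Delta : 'I_n -> {fset mindex m}).
Hypothesis hz : forall i, dom c (z i).
Context (f : 'rV[R]_d.+1 -> R) (g : 'I_n -> 'rV[R]_d.+1 -> R).
Hypothesis hg : cardinal_basis c z Delta g.

Local Notation V := (coords c).
Local Notation k := (max_order Delta).

(** This is [taylor] read through [bwd c], with [fwd c (bwd c x)] replaced by [x]. The two agree on
    [V], and this form is visibly a polynomial, hence C^l for every [l]. *)
Definition local_taylor (i : 'I_n) (x : 'rV[R]_m) : R :=
  \sum_(b <- Delta i) Dloc c b f (z i) / (mindex_fact b)%:R *
    monomial b (x - fwd c (z i)).

Lemma coords_fwd u : dom c u -> V (fwd c u).
Proof. by move=> cu; exists u. Qed.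

Lemma bwd_coords x : V x -> dom c (bwd c x) /\ fwd c (bwd c x) = x.
Proof. by move=> [u cu <-]; rewrite (chart_fwdK hc). Qed.

Lemma mindex_deg_max_order i b : b \in Delta i -> (mindex_deg b <= k)%N.
Proof.
move=> bD; apply: (@leq_trans (\max_(e <- Delta i) mindex_deg e)%N); last exact: leq_bigmax.
by apply: leq_bigmax_seq.
Qed.

Lemma Ck_local_taylor l i : Ck l V (local_taylor i).
Proof.
have oV := chart_coords_open hc.
apply: Ck_sum => // b; apply: (CkM oV); first exact: Ck_cst.
exact: Ck_monomial.
Qed.

Lemma interpolant_local x : V x ->
  \sum_(i < n) local_taylor i x * g i (bwd c x) =
  interpolant c z Delta f g (bwd c x).
Proof.
move=> Vx; apply: eq_bigr => i _; congr (_ * _).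
by apply: eq_bigr => b _; rewrite (bwd_coords Vx).2.
Qed.

Lemma CkU_interpolant : CkU c k (interpolant c z Delta f g).
Proof.
have oV := chart_coords_open hc.
apply: (eq_Ck oV interpolant_local); apply: (Ck_sum _ oV) => i.
by apply: (CkM oV); [exact: Ck_local_taylor|exact: cardinal_Ck hg i].
Qed.

(** At the center only the term of index [b] survives, and the factor [mindex_fact b] it produces
    cancels the denominator. *)
Lemma mpartial_local_taylor i b : b \in Delta i ->
  mpartial b (local_taylor i) (fwd c (z i)) = Dloc c b f (z i).
Proof.
have oV := chart_coords_open hc; move=> bD.
rewrite (mpartial_sum _ oV _ (coords_fwd (hz i))); last first.
  by move=> e; apply: (CkM oV); [exact: Ck_cst|exact: Ck_monomial oV].
rewrite (bigD1_seq b)//= big1 => [|e /negPf eb]; last first.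
  by rewrite mpartial_monomial eb.
rewrite mpartial_monomial eqxx addr0 divfK// pnatr_eq0 -lt0n.
by apply: prodn_gt0 => a; exact: fact_gt0.
Qed.

Lemma cardinal_le1 j u : dom c u -> g j u <= 1.
Proof.
move=> cu; rewrite -(cardinal_sum1 hg cu) (bigD1 j)//= lerDl.
by apply: sumr_ge0 => i _; exact: cardinal_ge0 hg i u cu.
Qed.

(* The values of [g j] lie in [0, 1], and [g j (z i)] is 0 or 1. *)
Lemma cardinal_partial0 a i j : (0 < k)%N ->
  partial a (g j \o bwd c) (fwd c (z i)) = 0.
Proof.
move=> k0; apply: (partial_extremum _ (chart_coords_open hc)).
- exact: Ck_leq k0 (cardinal_Ck hg j).
- exact: coords_fwd.
- rewrite /= (chart_fwdK hc)// (cardinal_delta hg).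
  have [_|_] := eqVneq j i; [right|left] => x /bwd_coords[cx _].
    exact: cardinal_le1.
  exact: cardinal_ge0 hg j _ cx.
Qed.

Lemma Dloc_interpolant i b : b \in Delta i -> flat_in_gaps c z Delta g i b ->
  Dloc c b (interpolant c z Delta f g) (z i) = Dloc c b f (z i).
Proof.
move=> bD gap; have oV := chart_coords_open hc; have Vi := coords_fwd (hz i).
have bk := mindex_deg_max_order bD.
have Cg j : Ck (mindex_deg b) V (g j \o bwd c).
  exact: Ck_leq bk (cardinal_Ck hg j).
have flat j e : mindex_le e b -> mindex_deg e != 0%N ->
    mpartial e (g j \o bwd c) (fwd c (z i)) = 0.
  move=> eb e0; have [eD|eD] := boolP (e \in Delta i).
    exact: cardinal_flat hg i j e eD e0.
  have [e1|] := ltnP 1 (mindex_deg e); first exact: gap eb eD e1.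
  rewrite leq_eqVlt ltnS leqn0 (negPf e0) orbF => /eqP e1.
  have [a ->] := @mindex_deg1 R m e e1; apply: (cardinal_partial0 a i j).
  (* Here [0 < k] because 1 = |e| <= |b| <= k. *)
  apply: leq_trans bk; rewrite -e1; apply: leq_sum => a' _; exact: eb.
rewrite /Dloc -(eq_mpartial b oV interpolant_local Vi).
rewrite (mpartial_sum _ oV _ Vi) => [|j]; last first.
  by apply: (CkM oV); [exact: Ck_local_taylor|exact: Cg].
under eq_bigr => j _.
  rewrite (mpartialM_flat oV (Ck_local_taylor _ j) (Cg j) Vi (flat j)) /=.
  rewrite (chart_fwdK hc)// (cardinal_delta hg).
  over.
(* For [j != i] the factor [g j (z i) = 0] removes the term, whatever the derivative of
   [local_taylor j] is there. *)
rewrite (bigD1 i)//= eqxx mulr1 big1 => [|j /negPf ->]; last by rewrite mulr0.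
by rewrite addr0 mpartial_local_taylor.
Qed.

End Interpolation.

Theorem mainTheorem1 (R : realType) (d m n : nat) (hd : (2 <= d)%N)
  (M : set 'rV[R]_d.+1) (hM : riemannian_structure m M)
  (c : coord_patch R d m) (hc : is_chart M c)
  (z : 'I_n -> 'rV[R]_d.+1) (hz : forall i, dom c (z i)) (z_inj : injective z)
  (Delta : 'I_n -> {fset mindex m})
  (f : 'rV[R]_d.+1 -> R) (hf : CkU c (max_order Delta) f)
  (g : 'I_n -> 'rV[R]_d.+1 -> R) (hg : cardinal_basis c z Delta g) :
  let H := interpolant c z Delta f g in
  [/\ CkU c (max_order Delta) H,
      (forall (i : 'I_n) (b : mindex m), b \in Delta i ->
         flat_in_gaps c z Delta g i b ->
         Dloc c b H (z i) = Dloc c b f (z i))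
    & (forall u, dom c u ->
         H u = \sum_(i < n) \sum_(b <- Delta i)
                 Dloc c b f (z i) * hermite_basis c z g i b u)].
Proof.
move=> H; split.
- exact: (CkU_interpolant hc f hg).
- by move=> i b; exact: (Dloc_interpolant hc hz f hg).
- move=> u _; apply: eq_bigr => i _; rewrite /taylor mulr_suml.
  by apply: eq_bigr => b _; rewrite /hermite_basis !mulrA [in LHS](mulrAC (Dloc _ _ _ _)).
Qed.
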